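(* For every integer $p\ge 1$, $$-2\sum_{n=0}^{\infty} \frac{\zeta(2n)}{(2n+p)4^n} = \log 2+\sum_{k=1}^{\lfloor p/2\rfloor} \frac{p!\,(-1)^k(4^k-1)\,\zeta(2k+1)}{(p-2k)!\,(2\pi)^{2k}}+\delta_{\lfloor \frac{p}{2} \rfloor, \frac{p}{2}}\frac{p!\,(-1)^{\frac{p}{2}}\zeta(p+1)}{\pi^p}.$$
   Context: $\zeta$ is the Riemann zeta function, with $\zeta(0)=-\tfrac12$. $\delta_{a,b}$ is the Kronecker delta, so $\delta_{\lfloor n/2\rfloor,n/2}$ is $1$ if $n$ is even and $0$ if $n$ is odd; a term multiplied by it is read as $0$ when $n$ is odd. Empty sums are $0$. *)

(* Defs.v *)
From Stdlib Require Import Reals.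
From Coquelicot Require Import Coquelicot.
Open Scope R_scope.

(** The Riemann zeta function at the nonnegative integers [s <> 1]: the value of
    the analytic continuation at [0], and the (convergent) Dirichlet series
    for [s >= 2]; the index of the series is shifted so that it starts at
    [1 / 1 ^ s].  At the pole [s = 1] the value is meaningless. *)
Definition zeta (s : nat) : R :=
  match s with
  | O => - (1 / 2)
  | _ => Series (fun n : nat => 1 / INR (n + 1) ^ s)
  end.

(* Main.v *)
Require Import Defs.
From Stdlib Require Import Reals Arith Factorial Lra Lia ZArith.
From Coquelicot Require Import Coquelicot.
Open Scope R_scope.

(** The function [t * (PI / 2) * cot (PI / 2 * t)], called [xcot] below, is
    expanded on the interval from [0] to [1] in two ways, and both expansions
    are integrated against [t ^ (p - 1)].

    On the one hand it is the generating function
    [- 2 * sum_n zeta (2 * n) * (t / 2) ^ (2 * n)].  This follows from the partial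
    fractions of the cotangent ([cot_partial_fractions]) by expanding each
    fraction into a geometric series; the remainder after the term of index [n]
    is at most [(1 / 4) ^ n] ([xcot_remainder]), so that term by term integration
    is legitimate and the integral is the left-hand side
    ([zeta_series_integral]).

    On the other hand [cot (PI / 2 * t)] is, in a weak sense,
    [2 * sum_k sin (k * PI * t)] over [k >= 1]: multiplying the partial sums by
    [sin (PI / 2 * t)] makes them telescope, and what remains oscillates and
    disappears in the limit when it is integrated against a continuous function
    ([dirichlet_sin]).  So the integral is also the sum over [k] of [PI] times the
    moments of [t ^ p] against [sin (k * PI * t)] ([xcot_moment]).  Two
    integrations by parts give a recursion for these moments ([sin_moment_SS]),
    hence a closed form, a finite combination of [(-1) ^ (k - 1) / k ^ (2 * j + 1)]
    and, for even [p], of [1 / k ^ (p + 1)].  Summing over [k] produces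
    [ln 2] for [j = 0], the values [(1 - 2 / 2 ^ s) * zeta s] at
    [s = 2 * j + 1] for [j >= 1], and [zeta (p + 1)] ([sin_moment_sum]).

    The cosine analogue of the telescoping argument ([dirichlet_cos]) is the
    pointwise convergence of the Fourier series of [cos (PI * a * (1 - t))] at
    [t = 0], which is the partial fraction expansion of the cotangent.  The
    vanishing of the oscillating integrals is deduced from the inequality of
    Bessel, so that continuity of the integrands is enough; the function [sinc],
    continuous and positive where it is needed, removes the singularity of
    [1 / sin (PI / 2 * t)] at [0]. *)

(** * Continuous functions on the unit interval and their integrals *)

Definition cont01 (f : R -> R) : Prop := forall t, 0 <= t <= 1 -> continuous f t.

Definition int01 (f : R -> R) : R := RInt f 0 1.

Lemma cont01_plus f g : cont01 f -> cont01 g -> cont01 (fun t => f t + g t).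
Proof. intros hf hg t ht. apply (continuous_plus f g t); auto. Qed.

Lemma cont01_minus f g : cont01 f -> cont01 g -> cont01 (fun t => f t - g t).
Proof. intros hf hg t ht. apply (continuous_minus f g t); auto. Qed.

Lemma cont01_mult f g : cont01 f -> cont01 g -> cont01 (fun t => f t * g t).
Proof. intros hf hg t ht. apply (continuous_mult f g t); auto. Qed.

Lemma cont01_derive f : (forall t, ex_derive f t) -> cont01 f.
Proof. intros h t _. apply (ex_derive_continuous f t), h. Qed.

Lemma cont01_const c : cont01 (fun _ => c).
Proof. intros t _. apply continuous_const. Qed.

(** Follows the syntax of sums, differences and products; leaves it to [auto_derive]
    to deal with atoms, and returns the atoms that it cannot treat. *)
Ltac cont :=
  lazymatch goal with
  | |- cont01 (fun _ => ?c) => apply cont01_const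
  | |- cont01 (fun t => @?f t + @?g t) => apply (cont01_plus f g); cont
  | |- cont01 (fun t => @?f t - @?g t) => apply (cont01_minus f g); cont
  | |- cont01 (fun t => @?f t * @?g t) => apply (cont01_mult f g); cont
  | |- cont01 _ =>
      first [ assumption
            | match goal with h : forall n, cont01 _ |- _ => apply h end
            | solve [ apply cont01_derive; intros; auto_derive; auto ]
            | idtac ]
  | |- _ => idtac
  end.

Lemma cont01_inv f : cont01 f -> (forall t, 0 <= t <= 1 -> f t <> 0) ->
  cont01 (fun t => / f t).
Proof.
  intros hf h0 t ht. apply (continuous_comp f Rinv); auto.
  apply (ex_derive_continuous Rinv). auto_derive. auto.
Qed.

Lemma cont01_sum (f : nat -> R -> R) n : (forall k, cont01 (f k)) ->
  cont01 (fun t => sum_n (fun k => f k t) n).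
Proof.
  intros hf. induction n; intros t ht.
  - apply (continuous_ext (f 0%nat)); [intros; now rewrite sum_O | now apply hf].
  - apply (continuous_ext (fun t => sum_n (fun k => f k t) n + f (S n) t)).
    + intros x. now rewrite sum_Sn.
    + apply cont01_plus; auto.
Qed.

Lemma cont01_ex_RInt f : cont01 f -> ex_RInt f 0 1.
Proof.
  intros hf. apply (@ex_RInt_continuous R_CompleteNormedModule). intros z hz.
  rewrite Rmin_left, Rmax_right in hz by lra. auto.
Qed.

Lemma int01_ext f g : (forall t, 0 < t < 1 -> f t = g t) -> int01 f = int01 g.
Proof.
  intros h. apply RInt_ext. intros t ht.
  rewrite Rmin_left, Rmax_right in ht by lra. auto.
Qed.

Lemma int01_plus f g : cont01 f -> cont01 g ->
  int01 (fun t => f t + g t) = int01 f + int01 g.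
Proof. intros. apply (RInt_plus f g); apply cont01_ex_RInt; assumption. Qed.

Lemma int01_minus f g : cont01 f -> cont01 g ->
  int01 (fun t => f t - g t) = int01 f - int01 g.
Proof. intros. apply (RInt_minus f g); apply cont01_ex_RInt; assumption. Qed.

Lemma int01_scal c f : cont01 f -> int01 (fun t => c * f t) = c * int01 f.
Proof. intros. apply (RInt_scal f); apply cont01_ex_RInt; assumption. Qed.

Lemma int01_le f g : cont01 f -> cont01 g ->
  (forall t, 0 < t < 1 -> f t <= g t) -> int01 f <= int01 g.
Proof. intros hf hg h. apply RInt_le; [lra | now apply cont01_ex_RInt .. | exact h]. Qed.

Lemma int01_const c : int01 (fun _ => c) = c.
Proof.
  unfold int01. rewrite RInt_const. unfold scal; simpl. unfold mult; simpl. ring.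
Qed.

Lemma int01_derive (F f : R -> R) : cont01 f ->
  (forall t, 0 <= t <= 1 -> is_derive F t (f t)) -> int01 f = F 1 - F 0.
Proof.
  intros hf hF. apply is_RInt_unique.
  apply (is_RInt_derive F f 0 1); intros t ht;
    rewrite Rmin_left, Rmax_right in ht by lra; auto.
Qed.

Lemma int01_sum (f : nat -> R -> R) n : (forall k, cont01 (f k)) ->
  int01 (fun t => sum_n (fun k => f k t) n) = sum_n (fun k => int01 (f k)) n.
Proof.
  intros hf. induction n.
  - rewrite sum_O. apply int01_ext. intros. now rewrite sum_O.
  - rewrite sum_Sn, <- IHn.
    rewrite (int01_ext _ (fun t => sum_n (fun k => f k t) n + f (S n) t))
      by (intros; now rewrite sum_Sn).
    apply int01_plus; [now apply cont01_sum | auto].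
Qed.

Lemma int01_pow m : int01 (fun t => t ^ m) = / INR (S m).
Proof.
  assert (h : INR (S m) <> 0) by now apply not_0_INR.
  rewrite (int01_derive (fun t => t ^ (S m) / INR (S m))).
  - rewrite pow1, pow_i by lia. field; auto.
  - cont.
  - intros t _. auto_derive; auto.
    change (match m with 0%nat => 1 | S _ => INR m + 1 end) with (INR (S m)).
    simpl Init.Nat.pred. field. auto.
Qed.

(** Term by term integration, with an error bound that may depend on [t] as long as
    its integral tends to [0]. *)
Lemma int01_lim (f : R -> R) (s e : nat -> R -> R) :
  cont01 f -> (forall n, cont01 (s n)) -> (forall n, cont01 (e n)) ->
  (forall n t, 0 < t < 1 -> Rabs (f t - s n t) <= e n t) ->
  is_lim_seq (fun n => int01 (e n)) 0 ->
  is_lim_seq (fun n => int01 (s n)) (int01 f).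
Proof.
  intros hf hs he hb hl.
  apply is_lim_seq_le_le with (u := fun n => int01 f - int01 (e n))
    (w := fun n => int01 f + int01 (e n)).
  - intros n. rewrite <- int01_minus, <- int01_plus by auto.
    split; apply int01_le; cont; auto; intros t ht;
      specialize (hb n t ht); apply Rabs_le_between in hb; lra.
  - replace (Finite (int01 f)) with (Finite (int01 f - 0)) by (f_equal; ring).
    apply is_lim_seq_minus'; auto. apply is_lim_seq_const.
  - replace (Finite (int01 f)) with (Finite (int01 f + 0)) by (f_equal; ring).
    apply is_lim_seq_plus'; auto. apply is_lim_seq_const.
Qed.

(** * Real series *)

(* The statements with suffix [_R] fix the carrier to [R]: their general forms leave
   equations in an abstract module, where [ring] and [field] do not apply. *)

Lemma sum_n_ext_R (a b : nat -> R) n :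
  (forall k, a k = b k) -> sum_n a n = sum_n b n.
Proof. exact (sum_n_ext a b n). Qed.

Lemma sum_n_m_ext_loc_R (a b : nat -> R) n m :
  (forall k, (n <= k <= m)%nat -> a k = b k) -> sum_n_m a n m = sum_n_m b n m.
Proof. exact (sum_n_m_ext_loc a b n m). Qed.

Lemma is_series_ext_R (a b : nat -> R) (l : R) :
  (forall n, a n = b n) -> is_series a l -> is_series b l.
Proof. exact (is_series_ext a b l). Qed.

Lemma is_series_minus_R (a b : nat -> R) (la lb : R) :
  is_series a la -> is_series b lb -> is_series (fun n => a n - b n) (la - lb).
Proof. intros ha hb. exact (is_series_minus a b la lb ha hb). Qed.

Lemma is_series_plus_R (a b : nat -> R) (la lb : R) :
  is_series a la -> is_series b lb -> is_series (fun n => a n + b n) (la + lb).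
Proof. intros ha hb. exact (is_series_plus a b la lb ha hb). Qed.

Lemma is_series_scal_R (c : R) (a : nat -> R) (la : R) :
  is_series a la -> is_series (fun n => c * a n) (c * la).
Proof. intros ha. exact (is_series_scal c a la ha). Qed.

Lemma is_series_sum_n (f : nat -> nat -> R) (l : nat -> R) m :
  (forall j, is_series (f j) (l j)) ->
  is_series (fun k => sum_n (fun j => f j k) m) (sum_n l m).
Proof.
  intros h. induction m.
  - rewrite sum_O. apply is_series_ext_R with (2 := h 0%nat).
    intros k. now rewrite sum_O.
  - rewrite sum_Sn. apply is_series_ext_R with (2 := is_series_plus_R _ _ _ _ IHm (h (S m))).
    intros k. now rewrite sum_Sn.
Qed.

Lemma is_series_telescope (u : nat -> R) (l : R) :
  is_lim_seq u l -> is_series (fun k => u (S k) - u k) (l - u 0%nat).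
Proof.
  intros hu. change (is_lim_seq (sum_n (fun k => u (S k) - u k)) (l - u 0%nat)).
  apply (is_lim_seq_ext (fun n => u (S n) - u 0%nat)).
  - induction n.
    + rewrite sum_O. reflexivity.
    + rewrite sum_Sn, <- IHn. unfold plus; simpl. ring.
  - apply is_lim_seq_minus'; [|apply is_lim_seq_const].
    now apply (is_lim_seq_incr_1 u).
Qed.

(** * Bessel inequality and oscillating integrals *)

(** Subtracting from [f] its component along [e n] changes neither the other
    coefficients nor continuity, and lowers the integral of the square by exactly
    [2 * (int01 (f * e n)) ^ 2]; so the bound follows by induction on [n] for all
    [f] at once. *)
Lemma bessel (e : nat -> R -> R) (he : forall n, cont01 (e n))
  (horth : forall i j,
     int01 (fun t => e i t * e j t) = if Nat.eqb i j then 1 / 2 else 0) :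
  forall n f, cont01 f ->
  2 * sum_n (fun k => (int01 (fun t => f t * e k t)) ^ 2) n
    <= int01 (fun t => f t * f t).
Proof.
  set (b := fun f k => int01 (fun t => f t * e k t)).
  set (r := fun n f t => f t - 2 * b f n * e n t).
  assert (hr : forall n f, cont01 f -> cont01 (r n f)).
  { intros n f hf. unfold r. cont; auto. }
  assert (hb : forall n f k, cont01 f -> n <> k -> b (r n f) k = b f k).
  { intros n f k hf hnk. unfold b at 1.
    rewrite (int01_ext _ (fun t => f t * e k t - 2 * b f n * (e n t * e k t)))
      by (intros; unfold r; ring).
    rewrite int01_minus, int01_scal, horth by (cont; auto).
    apply Nat.eqb_neq in hnk. rewrite hnk. unfold b. ring. }
  assert (hs : forall n f, cont01 f ->
    int01 (fun t => r n f t * r n f t)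
    = int01 (fun t => f t * f t) - 2 * (b f n) ^ 2).
  { intros n f hf.
    rewrite (int01_ext _ (fun t => f t * f t - 4 * b f n * (f t * e n t)
       + 4 * (b f n) ^ 2 * (e n t * e n t))) by (intros; unfold r; ring).
    rewrite int01_plus, int01_minus, !int01_scal, horth, Nat.eqb_refl by (cont; auto).
    unfold b. field. }
  assert (h0 : forall f, cont01 f -> 0 <= int01 (fun t => f t * f t)).
  { intros f hf. rewrite <- (int01_const 0). apply int01_le; cont.
    intros; nra. }
  induction n; intros f hf.
  - rewrite sum_O. specialize (hs 0%nat f hf).
    pose proof (h0 _ (hr 0%nat f hf)). unfold b in *. lra.
  - rewrite sum_Sn. specialize (IHn _ (hr (S n) f hf)). rewrite hs in IHn by auto.
    rewrite (sum_n_ext_loc _ (fun k => (b f k) ^ 2)) in IHn.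
    + unfold plus; simpl. unfold b in *; simpl in *. lra.
    + intros k hk. f_equal. apply (hb (S n) f k hf). lia.
Qed.

(** The squares of the coefficients have bounded partial sums, so they form a
    convergent series and tend to [0]. *)
Lemma riemann_lebesgue (e : nat -> R -> R) (he : forall n, cont01 (e n))
  (horth : forall i j,
     int01 (fun t => e i t * e j t) = if Nat.eqb i j then 1 / 2 else 0) f :
  cont01 f -> is_lim_seq (fun k => int01 (fun t => f t * e k t)) 0.
Proof.
  intros hf. set (b := fun k => int01 (fun t => f t * e k t)).
  assert (h : ex_series (fun k => (b k) ^ 2)).
  { destruct (ex_finite_lim_seq_incr (sum_n (fun k => (b k) ^ 2))
      (int01 (fun t => f t * f t) / 2)) as [l hl].
    - intros n. rewrite sum_Sn. unfold plus; simpl. nra.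
    - intros n. pose proof (bessel e he horth n f hf). unfold b in *. lra.
    - exists l. exact hl. }
  apply ex_series_lim_0 in h.
  apply is_lim_seq_abs_0.
  apply (is_lim_seq_ext (fun k => sqrt ((b k) ^ 2))).
  { intros k. rewrite <- Rsqr_pow2. apply sqrt_Rsqr_abs. }
  rewrite <- sqrt_0. apply is_lim_seq_continuous; auto.
  apply continuity_pt_sqrt; lra.
Qed.

(** * The trigonometric system on the unit interval *)

(** Indices are shifted by one to agree with the Dirichlet series of [zeta]. *)
Definition freq (k : nat) : R := INR (k + 1) * PI.

Lemma INR_add1_pos k : 0 < INR (k + 1).
Proof. apply lt_0_INR. lia. Qed.

Lemma INR_add1_ge1 k : 1 <= INR (k + 1).
Proof. rewrite plus_INR. simpl. pose proof (pos_INR k). lra. Qed.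

Lemma freq_pos k : 0 < freq k.
Proof. apply Rmult_lt_0_compat; [apply INR_add1_pos | apply PI_RGT_0]. Qed.

Lemma sin_freq k : sin (freq k) = 0.
Proof.
  apply sin_eq_0_1. exists (Z.of_nat (k + 1)). unfold freq. now rewrite INR_IZR_INZ.
Qed.

Lemma cos_freq k : cos (freq k) = (-1) ^ (k + 1).
Proof.
  unfold freq. induction (k + 1)%nat.
  - simpl. rewrite Rmult_0_l. apply cos_0.
  - rewrite S_INR. replace ((INR n + 1) * PI) with (INR n * PI + PI) by ring.
    rewrite neg_cos, IHn. simpl. ring.
Qed.

Lemma int01_cos c : c <> 0 -> int01 (fun t => cos (c * t)) = sin c / c.
Proof.
  intros hc. rewrite (int01_derive (fun t => sin (c * t) / c)).
  - rewrite Rmult_1_r, Rmult_0_r, sin_0. field; auto.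
  - cont.
  - intros t _. auto_derive; auto. field; auto.
Qed.

Lemma int01_cos_Z (m : Z) :
  int01 (fun t => cos (IZR m * PI * t)) = if Z.eqb m 0 then 1 else 0.
Proof.
  destruct (Z.eqb_spec m 0) as [-> | hm].
  - rewrite <- (int01_const 1). apply int01_ext. intros t _.
    rewrite !Rmult_0_l. apply cos_0.
  - rewrite int01_cos.
    + rewrite sin_eq_0_1 by (now exists m). unfold Rdiv. ring.
    + apply Rmult_integral_contrapositive. split.
      * now apply not_0_IZR.
      * apply PI_neq0.
Qed.

(** Covers both orthogonality relations: [s = 1] gives the product of two cosines
    and [s = -1] that of two sines. *)
Lemma int01_product_to_sum i j (s : R) :
  int01 (fun t => 1 / 2 * (cos (IZR (Z.of_nat i - Z.of_nat j) * PI * t)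
     + s * cos (IZR (Z.of_nat i + Z.of_nat j + 2) * PI * t)))
  = if Nat.eqb i j then 1 / 2 else 0.
Proof.
  rewrite int01_scal, int01_plus, int01_scal, !int01_cos_Z by cont.
  destruct (Z.eqb_spec (Z.of_nat i + Z.of_nat j + 2) 0); [lia|].
  destruct (Nat.eqb_spec i j), (Z.eqb_spec (Z.of_nat i - Z.of_nat j) 0); try lia; lra.
Qed.

Lemma freq_mult_IZR k t : freq k * t = (IZR (Z.of_nat k) + 1) * PI * t.
Proof. unfold freq. rewrite plus_INR, <- INR_IZR_INZ. simpl. ring. Qed.

Lemma cos_freq_orthogonal i j :
  int01 (fun t => cos (freq i * t) * cos (freq j * t))
  = if Nat.eqb i j then 1 / 2 else 0.
Proof.
  rewrite <- (int01_product_to_sum i j 1). apply int01_ext. intros t _.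
  rewrite !freq_mult_IZR, minus_IZR, !plus_IZR.
  set (x := (IZR (Z.of_nat i) + 1) * PI * t). set (y := (IZR (Z.of_nat j) + 1) * PI * t).
  replace (_ * PI * t) with (x - y) by (unfold x, y; ring).
  replace (_ * PI * t) with (x + y) by (unfold x, y; ring).
  rewrite cos_minus, cos_plus. field.
Qed.

Lemma sin_freq_orthogonal i j :
  int01 (fun t => sin (freq i * t) * sin (freq j * t))
  = if Nat.eqb i j then 1 / 2 else 0.
Proof.
  rewrite <- (int01_product_to_sum i j (-1)). apply int01_ext. intros t _.
  rewrite !freq_mult_IZR, minus_IZR, !plus_IZR.
  set (x := (IZR (Z.of_nat i) + 1) * PI * t). set (y := (IZR (Z.of_nat j) + 1) * PI * t).
  replace (_ * PI * t) with (x - y) by (unfold x, y; ring).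
  replace (_ * PI * t) with (x + y) by (unfold x, y; ring).
  rewrite cos_minus, cos_plus. field.
Qed.

Lemma riemann_lebesgue_cos f : cont01 f ->
  is_lim_seq (fun k => int01 (fun t => f t * cos (freq k * t))) 0.
Proof.
  apply (riemann_lebesgue (fun k t => cos (freq k * t))).
  - intros. cont.
  - apply cos_freq_orthogonal.
Qed.

Lemma riemann_lebesgue_sin f : cont01 f ->
  is_lim_seq (fun k => int01 (fun t => f t * sin (freq k * t))) 0.
Proof.
  apply (riemann_lebesgue (fun k t => sin (freq k * t))).
  - intros. cont.
  - apply sin_freq_orthogonal.
Qed.

(** * Telescoping with the Dirichlet kernels *)

(** The frequencies of the Dirichlet kernels: products of [cos (freq k * t)] or
    [sin (freq k * t)] with [2 * sin (PI / 2 * t)] are differences of terms of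
    frequencies [half_freq (S k)] and [half_freq k]. *)
Definition half_freq (k : nat) : R := (INR k + 1 / 2) * PI.

Lemma half_freq_plus k t : half_freq (S k) * t = freq k * t + PI / 2 * t.
Proof. unfold half_freq, freq. rewrite S_INR, plus_INR. simpl. field. Qed.

Lemma half_freq_minus k t : half_freq k * t = freq k * t - PI / 2 * t.
Proof. unfold half_freq, freq. rewrite plus_INR. simpl. field. Qed.

Lemma half_freq_0 t : half_freq 0 * t = PI / 2 * t.
Proof. unfold half_freq. simpl. field. Qed.

(** With [u k] the integral of [h t * sin (half_freq k * t)], the term of index [k]
    is [u (S k) - u k]; moreover [u] tends to [0] and [u 0] is the integral of [f].
    This says that the Fourier cosine series of [f] converges to [0] at [0], a
    point where [f] vanishes. *)
Lemma dirichlet_cos f h : cont01 f -> cont01 h ->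
  (forall t, 0 < t < 1 -> f t = h t * sin (PI / 2 * t)) ->
  is_series (fun k => 2 * int01 (fun t => f t * cos (freq k * t))) (- int01 f).
Proof.
  intros hf hh hfh.
  set (u := fun k => int01 (fun t => h t * sin (half_freq k * t))).
  assert (hu : is_lim_seq u 0).
  { apply is_lim_seq_incr_1.
    apply (is_lim_seq_ext (fun k =>
      int01 (fun t => (h t * cos (PI / 2 * t)) * sin (freq k * t))
      + int01 (fun t => (h t * sin (PI / 2 * t)) * cos (freq k * t)))).
    - intros k. rewrite <- int01_plus by cont. apply int01_ext. intros t _.
      rewrite half_freq_plus, sin_plus. ring.
    - replace (Finite 0) with (Finite (0 + 0)) by (f_equal; ring).
      apply is_lim_seq_plus'; [apply riemann_lebesgue_sin | apply riemann_lebesgue_cos]; cont. }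
  replace (- int01 f) with (0 - u 0%nat).
  - apply is_series_ext_R with (2 := is_series_telescope u 0 hu).
    intros k. rewrite <- int01_scal by cont. unfold u.
    rewrite <- int01_minus by cont. apply int01_ext. intros t ht.
    rewrite half_freq_plus, half_freq_minus, sin_plus, sin_minus, hfh by auto. ring.
  - unfold u. rewrite (int01_ext _ f); [ring|]. intros t ht.
    now rewrite half_freq_0, hfh.
Qed.

(** The same telescoping with cosines: [u 0] is now, up to sign, the integral of
    [h t * cos (PI / 2 * t)], that is of [f t * cot (PI / 2 * t)]. *)
Lemma dirichlet_sin f h : cont01 f -> cont01 h ->
  (forall t, 0 < t < 1 -> f t = h t * sin (PI / 2 * t)) ->
  is_series (fun k => 2 * int01 (fun t => f t * sin (freq k * t)))
    (int01 (fun t => h t * cos (PI / 2 * t))).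
Proof.
  intros hf hh hfh.
  set (u := fun k => - int01 (fun t => h t * cos (half_freq k * t))).
  assert (hu : is_lim_seq u 0).
  { apply is_lim_seq_incr_1.
    apply (is_lim_seq_ext (fun k =>
      int01 (fun t => (h t * sin (PI / 2 * t)) * sin (freq k * t))
      - int01 (fun t => (h t * cos (PI / 2 * t)) * cos (freq k * t)))).
    - intros k. unfold u. rewrite <- int01_minus by cont.
      replace (- int01 (fun t => h t * cos (half_freq (S k) * t)))
        with ((-1) * int01 (fun t => h t * cos (half_freq (S k) * t))) by ring.
      rewrite <- int01_scal by cont. apply int01_ext. intros t _.
      rewrite half_freq_plus, cos_plus. ring.
    - replace (Finite 0) with (Finite (0 - 0)) by (f_equal; ring).
      apply is_lim_seq_minus'; [apply riemann_lebesgue_sin | apply riemann_lebesgue_cos]; cont. }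
  replace (int01 (fun t => h t * cos (PI / 2 * t))) with (0 - u 0%nat).
  - apply is_series_ext_R with (2 := is_series_telescope u 0 hu).
    intros k. rewrite <- int01_scal by cont. unfold u.
    replace (- int01 (fun t => h t * cos (half_freq (S k) * t))
      - - int01 (fun t => h t * cos (half_freq k * t))) with
     (int01 (fun t => h t * cos (half_freq k * t)) - int01 (fun t => h t * cos (half_freq (S k) * t)))
     by ring.
    rewrite <- int01_minus by cont. apply int01_ext. intros t ht.
    rewrite half_freq_plus, half_freq_minus, cos_plus, cos_minus, hfh by auto. ring.
  - unfold u. rewrite (int01_ext _ (fun t => h t * cos (PI / 2 * t))); [ring|].
    intros t ht. now rewrite half_freq_0.
Qed.

(** * Partial fractions of the cotangent *)

Definition sinc (x : R) : R := if Req_EM_T x 0 then 1 else sin x / x.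

Lemma sin_sinc x : sin x = x * sinc x.
Proof.
  unfold sinc. destruct (Req_EM_T x 0) as [-> | h].
  - rewrite sin_0. ring.
  - field; auto.
Qed.

Lemma continuous_sinc x : continuous sinc x.
Proof.
  destruct (Req_EM_T x 0) as [-> | h].
  - (* [sinc 0] is the limit of [sin x / x] at [0]. *)
    assert (hl : is_lim sinc 0 (sinc 0)).
    { unfold sinc at 2. destruct (Req_EM_T 0 0); [|lra].
      apply is_lim_ext_loc with (2 := is_lim_sinc_0).
      exists (mkposreal 1 Rlt_0_1). intros y _ hy. unfold sinc.
      destruct (Req_EM_T y 0); [contradiction|reflexivity]. }
    apply continuity_pt_filterlim, continuity_pt_filterlim'; exact hl.
  - apply (continuous_ext_loc sinc (fun y => sin y / y)).
    + assert (hx : 0 < Rabs x) by now apply Rabs_pos_lt.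
      exists (mkposreal _ hx). intros y hy. unfold sinc.
      destruct (Req_EM_T y 0) as [-> |]; auto. exfalso.
      unfold ball in hy; simpl in hy. unfold AbsRing_ball, abs, minus, plus, opp in hy.
      simpl in hy. rewrite Rplus_0_l, Rabs_Ropp in hy. lra.
    + apply (ex_derive_continuous (fun y => sin y / y)). auto_derive. auto.
Qed.

Lemma sinc_pos x : 0 <= x < PI -> 0 < sinc x.
Proof.
  intros hx. unfold sinc. destruct (Req_EM_T x 0); [lra|].
  apply Rdiv_lt_0_compat; [apply sin_gt_0|]; lra.
Qed.

Lemma cont01_sinc c : cont01 (fun t => sinc (c * t)).
Proof.
  intros t _. apply (continuous_comp (fun t => c * t) sinc).
  - apply (ex_derive_continuous (fun t => c * t)). auto_derive. auto.
  - apply continuous_sinc.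
Qed.

Lemma sinc_half_pos t : 0 <= t <= 1 -> 0 < sinc (PI / 2 * t).
Proof. intros ht. pose proof PI_RGT_0. apply sinc_pos. nra. Qed.

Lemma cont01_inv_sinc : cont01 (fun t => / sinc (PI / 2 * t)).
Proof.
  apply cont01_inv; [apply cont01_sinc|].
  intros t ht. pose proof (sinc_half_pos t ht). lra.
Qed.

(** The Fourier cosine series of [cos (PI * a * (1 - t))], whose coefficients are
    elementary, is evaluated at [t = 0] by applying [dirichlet_cos] to the difference
    with the value at [0].  That difference is
    [2 * sin (PI * a * (1 - t / 2)) * sin (PI / 2 * a * t)], and its quotient by
    [sin (PI / 2 * t)] extends continuously to [0] because both sines vanish there
    to first order. *)
Lemma cot_partial_fractions a : 0 < a <= 1 / 2 ->
  is_series (fun k => a ^ 2 / (INR (k + 1) ^ 2 - a ^ 2))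
    ((1 - PI * a * cos (PI * a) / sin (PI * a)) / 2).
Proof.
  intros ha. pose proof PI_RGT_0 as hpi.
  assert (hs : 0 < sin (PI * a)) by (apply sin_gt_0; nra).
  assert (ha' : PI * a <> 0) by nra.
  set (f := fun t => cos (PI * a * (1 - t)) - cos (PI * a)).
  set (h := fun t => 2 * sin (PI * a * (1 - t / 2))
    * (a * sinc (PI / 2 * a * t) * / sinc (PI / 2 * t))).
  assert (hf : cont01 f) by (unfold f; cont).
  assert (hh : cont01 h).
  { unfold h. cont. apply cont01_sinc. apply cont01_inv_sinc. }
  assert (hfh : forall t, 0 < t < 1 -> f t = h t * sin (PI / 2 * t)).
  { intros t ht. unfold f, h.
    pose proof (sinc_half_pos t ltac:(lra)) as h1.
    replace (cos (PI * a * (1 - t))) with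
      (cos (PI * a * (1 - t / 2) - PI / 2 * a * t)) by (f_equal; field).
    replace (cos (PI * a)) with
      (cos (PI * a * (1 - t / 2) + PI / 2 * a * t)) by (f_equal; field).
    rewrite cos_minus, cos_plus, (sin_sinc (PI / 2 * t)), (sin_sinc (PI / 2 * a * t)).
    field. lra. }
  pose proof (dirichlet_cos f h hf hh hfh) as hd.
  apply (is_series_scal_R (- (PI * a) / (2 * sin (PI * a)))) in hd.
  replace ((1 - PI * a * cos (PI * a) / sin (PI * a)) / 2)
    with (- (PI * a) / (2 * sin (PI * a)) * (- int01 f)).
  - apply is_series_ext_R with (2 := hd). intros k.
    pose proof (freq_pos k) as hw. pose proof (INR_add1_pos k) as hk.
    pose proof (INR_add1_ge1 k) as hk1.
    set (w := freq k) in *.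
    assert (hwa : 0 < w - PI * a) by (unfold w, freq; nra).
    assert (hwb : 0 < w + PI * a) by nra.
    (* Product to sum: both angles start at [PI * a] for [t = 0] and end at [w] and
       [- w], where the sine vanishes, for [t = 1]. *)
    rewrite (int01_derive (fun t =>
      (sin (PI * a + (w - PI * a) * t) / (w - PI * a)
       - sin (PI * a - (w + PI * a) * t) / (w + PI * a)) / 2
      - cos (PI * a) * sin (w * t) / w)).
    + replace (PI * a + (w - PI * a) * 1) with w by ring.
      replace (PI * a - (w + PI * a) * 1) with (- w) by ring.
      rewrite !Rmult_0_r, Rminus_0_r, Rplus_0_r, Rmult_1_r, sin_neg, sin_0.
      replace (sin w) with 0 by (symmetry; apply sin_freq).
      unfold w, freq in *.
      field. repeat split; nra.
    + unfold f; cont.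
    + intros t _. unfold f. auto_derive; [auto|].
      set (x := PI * a * (1 - t)).
      replace (PI * a + (w - PI * a) * t) with (x + w * t) by (unfold x; ring).
      replace (PI * a + - ((w + PI * a) * t)) with (x - w * t) by (unfold x; ring).
      rewrite cos_plus, cos_minus. field. lra.
  - rewrite (int01_derive (fun t =>
      - sin (PI * a * (1 - t)) / (PI * a) - cos (PI * a) * t)).
    + rewrite Rminus_0_r, Rminus_diag, !Rmult_0_r, !Rmult_1_r, sin_0.
      field. lra.
    + assumption.
    + intros t _. unfold f. auto_derive; auto. unfold Rminus. field. split; lra.
Qed.

(** * Dirichlet series of zeta and its alternating variant *)

(** Comparison with the telescoping series of
    [2 / (n + 1) - 2 / (n + 2)], which dominates [1 / (n + 1) ^ 2]. *)
Lemma zeta_is_series s : (2 <= s)%nat ->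
  is_series (fun n => 1 / INR (n + 1) ^ s) (zeta s).
Proof.
  intros hs. destruct s as [|s]; [lia|].
  apply Series_correct.
  apply (@ex_series_le R_AbsRing R_CompleteNormedModule _
    (fun n => (-2) / INR (S n + 1) - (-2) / INR (n + 1))).
  - intros n. pose proof (INR_add1_pos n) as hn.
    change (norm (1 / INR (n + 1) ^ S s)) with (Rabs (1 / INR (n + 1) ^ S s)).
    pose proof (INR_add1_ge1 n) as h1.
    rewrite Rabs_pos_eq.
    2:{ apply Rlt_le, Rdiv_lt_0_compat; [lra|]. now apply pow_lt. }
    apply Rle_trans with (1 / INR (n + 1) ^ 2).
    + apply Rmult_le_compat_l; [lra|]. apply Rinv_le_contravar; [nra|].
      apply Rle_pow; auto.
    + replace (INR (S n + 1)) with (INR (n + 1) + 1)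
        by (rewrite <- S_INR; f_equal; lia).
      set (x := INR (n + 1)) in *.
      apply Rminus_le.
      replace (1 / x ^ 2 - (-2 / (x + 1) - -2 / x)) with ((1 - x) / (x ^ 2 * (x + 1)))
        by (field; lra).
      apply Rmult_le_reg_r with (x ^ 2 * (x + 1)); [nra|].
      field_simplify; [lra | nra].
  - exists (0 - (-2) / INR (0 + 1)).
    apply (is_series_telescope (fun n => (-2) / INR (n + 1))).
    replace (Finite 0) with (Rbar_mult (-2) 0) by (simpl; f_equal; ring).
    apply is_lim_seq_scal_l.
    apply (is_lim_seq_ext (fun n => / INR (S n))).
    { intros n. now rewrite Nat.add_1_r. }
    apply (is_lim_seq_incr_1 (fun n => / INR n)).
    replace (Finite 0) with (Rbar_inv p_infty) by reflexivity.
    apply is_lim_seq_inv; [apply is_lim_seq_INR | discriminate].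
Qed.

(** Changing the sign of the terms of even base amounts to subtracting twice their
    sum, which is [2 / 2 ^ s * zeta s]; the identity is exact on the partial sums up
    to the base [2 * n + 2]. *)
Lemma alternating_zeta s : (2 <= s)%nat ->
  is_series (fun k => (-1) ^ k / INR (k + 1) ^ s) ((1 - 2 / 2 ^ s) * zeta s).
Proof.
  intros hs. pose proof (zeta_is_series s hs) as hz.
  set (z := fun k => 1 / INR (k + 1) ^ s) in *.
  set (e := fun k => (-1) ^ k / INR (k + 1) ^ s).
  assert (he : ex_series e).
  { apply ex_series_Rabs. exists (zeta s). apply is_series_ext_R with (2 := hz).
    intros n. unfold e, z, Rdiv. rewrite Rabs_mult, pow_1_abs, (Rabs_pos_eq (/ _)); auto.
    apply Rlt_le, Rinv_0_lt_compat, pow_lt, INR_add1_pos. }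
  destruct he as [l hl].
  assert (heq : forall n,
    sum_n z (2 * n + 1) - 2 / 2 ^ s * sum_n z n = sum_n e (2 * n + 1)).
  { assert (hstep : forall n, z (2 * n)%nat = e (2 * n)%nat /\
      z (2 * n + 1)%nat - 2 / 2 ^ s * z n = e (2 * n + 1)%nat).
    { intros n. unfold z, e. split.
      - now rewrite pow_1_even.
      - replace (2 * n + 1)%nat with (S (2 * n)) at 2 by lia.
        rewrite pow_1_odd. replace (2 * n + 1 + 1)%nat with (2 * (n + 1))%nat by lia.
        rewrite mult_INR, Rpow_mult_distr. simpl (INR 2).
        pose proof (pow_lt _ s (INR_add1_pos n)).
        replace (1 + 1) with 2 by ring. assert (0 < 2 ^ s) by (apply pow_lt; lra).
        field. lra. }
    induction n.
    - destruct (hstep 0%nat) as [h0 h1]. simpl in h0, h1. simpl (2 * 0 + 1)%nat.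
      rewrite !sum_Sn, !sum_O. unfold plus; simpl. lra.
    - destruct (hstep (S n)) as [h0 h1].
      replace (2 * S n + 1)%nat with (S (S (2 * n + 1))) in * by lia.
      replace (2 * S n)%nat with (S (2 * n + 1)) in * by lia.
      rewrite !sum_Sn, <- IHn. unfold plus; simpl (Hierarchy.plus _ _) in *.
      simpl. simpl in h0, h1. lra. }
  replace ((1 - 2 / 2 ^ s) * zeta s) with l; [exact hl|].
  assert (hsub : filterlim (fun n => 2 * n + 1)%nat eventually eventually)
    by (apply eventually_subseq; intros; lia).
  assert (h1 : is_lim_seq (fun n => sum_n e (2 * n + 1)) l)
    by (apply (is_lim_seq_subseq (sum_n e)); [exact hsub | exact hl]).
  assert (h2 : is_lim_seq (fun n => sum_n e (2 * n + 1)) (zeta s - 2 / 2 ^ s * zeta s)).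
  { apply (is_lim_seq_ext _ _ _ heq). apply is_lim_seq_minus'.
    - apply (is_lim_seq_subseq (sum_n z)); [exact hsub | exact hz].
    - apply (is_lim_seq_scal_l (sum_n z) (2 / 2 ^ s) (zeta s)). exact hz. }
  apply is_lim_seq_unique in h1, h2. rewrite h1 in h2. injection h2. lra.
Qed.

(** Integrate the geometric series of [1 / (1 + t)]; the remainder is at most
    [t ^ (n + 1)], whose integral tends to [0]. *)
Lemma alternating_harmonic : is_series (fun k => (-1) ^ k / INR (k + 1)) (ln 2).
Proof.
  assert (hc : cont01 (fun t => / (1 + t))).
  { apply cont01_inv; [cont; apply cont01_derive; intros; auto_derive; auto|].
    intros; lra. }
  assert (hk : forall k, cont01 (fun t => (-1) ^ k * t ^ k)) by (intros; cont).
  replace (ln 2) with (int01 (fun t => / (1 + t))).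
  2:{ rewrite (int01_derive (fun t => ln (1 + t))); auto.
      - rewrite Rplus_0_r, ln_1. replace (1 + 1) with 2 by ring. ring.
      - intros t ht. auto_derive; [lra|]. field. lra. }
  change (is_lim_seq (sum_n (fun k => (-1) ^ k / INR (k + 1)))
    (int01 (fun t => / (1 + t)))).
  apply (is_lim_seq_ext
    (fun n => int01 (fun t => sum_n (fun k => (-1) ^ k * t ^ k) n))).
  { intros n. rewrite int01_sum by auto. apply sum_n_ext_R. intros k.
    rewrite int01_scal, int01_pow, Nat.add_1_r by cont. reflexivity. }
  apply int01_lim with (e := fun n t => t ^ (S n)); auto.
  - intros n. now apply cont01_sum.
  - intros n. cont.
  - intros n t ht.
    assert (h : / (1 + t) - sum_n (fun k => (-1) ^ k * t ^ k) n
                = (-1) ^ (S n) * t ^ (S n) / (1 + t)).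
    { induction n.
      - rewrite sum_O. simpl. field. lra.
      - rewrite sum_Sn. unfold plus; simpl (Hierarchy.plus _ _).
        replace (/ (1 + t) - _) with
          ((/ (1 + t) - sum_n (fun k => (-1) ^ k * t ^ k) n)
           - (-1) ^ S n * t ^ S n) by (unfold plus; simpl; ring).
        rewrite IHn. simpl. field. lra. }
    rewrite h. unfold Rdiv. rewrite !Rabs_mult, pow_1_abs.
    pose proof (pow_lt t (S n) (proj1 ht)) as hp.
    rewrite (Rabs_pos_eq (t ^ S n)) by lra.
    rewrite Rabs_inv, (Rabs_pos_eq (1 + t)) by lra.
    rewrite Rmult_1_l. rewrite <- (Rmult_1_r (t ^ S n)) at 2.
    apply Rmult_le_compat_l; [lra|]. rewrite <- Rinv_1.
    apply Rinv_le_contravar; lra.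
  - apply (is_lim_seq_ext (fun n => / INR (S (S n)))).
    { intros n. now rewrite int01_pow. }
    apply (is_lim_seq_incr_1 (fun n => / INR (S n))), (is_lim_seq_incr_1 (fun n => / INR n)).
    replace (Finite 0) with (Rbar_inv p_infty) by reflexivity.
    apply is_lim_seq_inv; [apply is_lim_seq_INR | discriminate].
Qed.

(** * The generating function of zeta at even integers *)

(** This is [PI / 2 * t * cot (PI / 2 * t)], with its limit [1] at [t = 0]. *)
Definition xcot (t : R) : R := cos (PI / 2 * t) * / sinc (PI / 2 * t).

Lemma cont01_xcot : cont01 xcot.
Proof. unfold xcot. cont. apply cont01_inv_sinc. Qed.

(** With [a = t / 2] and [r = a ^ 2 / (k + 1) ^ 2], each partial fraction is
    [x = r / (1 - r)] and satisfies [r ^ n * x = r ^ (n + 1) + r ^ (n + 1) * x]; summing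
    over [k] moves one more zeta value out of the remainder.  The term of index [0]
    is accounted for by [zeta 0 = - 1 / 2]. *)
Lemma xcot_expansion t : 0 < t < 1 -> forall n,
  is_series (fun k => ((t / 2) ^ 2 / INR (k + 1) ^ 2) ^ n
      * ((t / 2) ^ 2 / (INR (k + 1) ^ 2 - (t / 2) ^ 2)))
    (- (1 / 2) * xcot t - sum_n (fun m => zeta (2 * m) * (t / 2) ^ (2 * m)) n).
Proof.
  intros ht. induction n.
  - rewrite sum_O.
    replace (_ - _) with ((1 - PI * (t / 2) * cos (PI * (t / 2)) / sin (PI * (t / 2))) / 2).
    + apply is_series_ext_R with (2 := cot_partial_fractions (t / 2) ltac:(lra)).
      intros k. now rewrite pow_O, Rmult_1_l.
    + simpl. unfold xcot. pose proof (sinc_half_pos t ltac:(lra)).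
      replace (PI * (t / 2)) with (PI / 2 * t) by field.
      rewrite (sin_sinc (PI / 2 * t)). pose proof PI_RGT_0. field. lra.
  - rewrite sum_Sn.
    pose proof (is_series_scal_R ((t / 2) ^ (2 * S n)) _ _
      (zeta_is_series (2 * S n) ltac:(lia))) as hz.
    pose proof (is_series_minus_R _ _ _ _ IHn hz) as h.
    match goal with |- is_series _ ?l => match type of h with is_series _ ?l' =>
      replace l with l' end end.
    + apply is_series_ext_R with (2 := h). intros k.
      pose proof (INR_add1_pos k) as hk.
      pose proof (INR_add1_ge1 k) as hk1.
      assert (0 < INR (k + 1) ^ 2 - (t / 2) ^ 2) by nra.
      set (x := (t / 2) ^ 2 / (INR (k + 1) ^ 2 - (t / 2) ^ 2)).
      set (r := (t / 2) ^ 2 / INR (k + 1) ^ 2).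
      replace ((t / 2) ^ (2 * S n) * (1 / INR (k + 1) ^ (2 * S n))) with (r ^ S n).
      * replace (r ^ S n * x) with (r ^ n * (r * x)) by (simpl; ring).
        replace (r * x) with (x - r) by (unfold r, x; field; lra). simpl. ring.
      * rewrite !pow_mult. unfold r, Rdiv. rewrite Rpow_mult_distr, pow_inv. ring.
    + change (plus ?a ?b) with (a + b). ring.
Qed.

(** Every ratio [(t / 2) ^ 2 / (k + 1) ^ 2] is at most [1 / 4], so the remainder is at
    most [(1 / 4) ^ n] times the one of index [0], which equals [(1 - xcot t) / 2]
    and is bounded by [1] because [xcot t >= 0]. *)
Lemma xcot_remainder t : 0 < t < 1 -> forall n,
  Rabs (- (1 / 2) * xcot t - sum_n (fun m => zeta (2 * m) * (t / 2) ^ (2 * m)) n)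
    <= (1 / 4) ^ n.
Proof.
  intros ht n. set (T := fun n k => ((t / 2) ^ 2 / INR (k + 1) ^ 2) ^ n
      * ((t / 2) ^ 2 / (INR (k + 1) ^ 2 - (t / 2) ^ 2))).
  pose proof (xcot_expansion t ht 0) as h0. pose proof (xcot_expansion t ht n) as hn.
  fold (T n) in hn. fold (T 0%nat) in h0.
  rewrite <- (is_series_unique _ _ hn).
  assert (hr : forall k, 0 <= (t / 2) ^ 2 / INR (k + 1) ^ 2 <= 1 / 4
     /\ 0 <= (t / 2) ^ 2 / (INR (k + 1) ^ 2 - (t / 2) ^ 2)).
  { intros k. pose proof (INR_add1_pos k) as hk.
    pose proof (INR_add1_ge1 k) as hk1.
    repeat split.
    - apply Rle_div_r; nra.
    - apply Rle_div_l; nra.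
    - apply Rle_div_r; nra. }
  assert (hT : forall k, 0 <= T n k <= (1 / 4) ^ n * T 0%nat k).
  { intros k. destruct (hr k) as [h1 h2]. unfold T. rewrite pow_O, Rmult_1_l. split.
    - apply Rmult_le_pos; [now apply pow_le | auto].
    - apply Rmult_le_compat_r; auto. now apply pow_incr. }
  assert (hT0 : Series (T 0%nat) <= 1).
  { rewrite (is_series_unique _ _ h0), sum_O. simpl.
    enough (0 <= xcot t) by lra. unfold xcot.
    pose proof (sinc_half_pos t ltac:(lra)). pose proof PI_RGT_0.
    apply Rmult_le_pos.
    - apply cos_ge_0; nra.
    - now apply Rlt_le, Rinv_0_lt_compat. }
  rewrite Rabs_pos_eq.
  - apply Rle_trans with (Series (fun k => (1 / 4) ^ n * T 0%nat k)).
    + apply Series_le; auto. apply (ex_series_scal_l (V := R_NormedModule)).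
      eexists; exact h0.
    + rewrite Series_scal_l. rewrite <- (Rmult_1_r ((1 / 4) ^ n)) at 2.
      apply Rmult_le_compat_l; auto. apply pow_le; lra.
  - replace 0 with (Series (fun k => 0 * T n k)) by (rewrite Series_scal_l; ring).
    apply Series_le; [|eexists; exact hn].
    intros k. pose proof (hT k). lra.
Qed.

(** Written with [q + 1] for the exponent so that the weight [t ^ q] needs no
    subtraction. *)
Lemma zeta_series_integral q :
  is_series (fun n => zeta (2 * n) / (INR (2 * n + S q) * 4 ^ n))
    (- (1 / 2) * int01 (fun t => t ^ q * xcot t)).
Proof.
  pose proof cont01_xcot as hx.
  set (g := fun m t => t ^ q * (zeta (2 * m) * (t / 2) ^ (2 * m))).
  assert (hg : forall m, cont01 (g m)) by (intros; unfold g; cont).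
  rewrite <- int01_scal by cont.
  change (is_lim_seq (sum_n (fun n => zeta (2 * n) / (INR (2 * n + S q) * 4 ^ n)))
    (int01 (fun t => - (1 / 2) * (t ^ q * xcot t)))).
  apply (is_lim_seq_ext (fun n => int01 (fun t => sum_n (fun m => g m t) n))).
  { intros n. rewrite int01_sum by auto. apply sum_n_ext_R. intros m.
    rewrite (int01_ext _ (fun t => zeta (2 * m) / 4 ^ m * t ^ (2 * m + q))).
    - rewrite int01_scal, int01_pow by cont.
      replace (2 * m + S q)%nat with (S (2 * m + q)) by lia.
      field. split; [apply pow_nonzero; lra | now apply not_0_INR].
    - intros t _. unfold g, Rdiv. rewrite Rpow_mult_distr, pow_add, (pow_mult (/ 2)).
      replace ((/ 2) ^ 2) with (/ 4) by field. rewrite pow_inv. ring. }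
  apply int01_lim with (e := fun n _ => (1 / 4) ^ n).
  - cont.
  - intros n. now apply cont01_sum.
  - intros n. cont.
  - intros n t ht. pose proof (xcot_remainder t ht n) as h.
    replace (sum_n (fun m => g m t) n) with
      (t ^ q * sum_n (fun m => zeta (2 * m) * (t / 2) ^ (2 * m)) n)
      by (symmetry; apply (sum_n_mult_l (K := R_Ring))).
    replace (_ - _) with (t ^ q *
      (- (1 / 2) * xcot t - sum_n (fun m => zeta (2 * m) * (t / 2) ^ (2 * m)) n)) by ring.
    assert (h0 : 0 <= t ^ q <= 1).
    { split; [apply pow_le; lra|]. rewrite <- (pow1 q). apply pow_incr. lra. }
    rewrite Rabs_mult, (Rabs_pos_eq (t ^ q)) by lra.
    pose proof (Rabs_pos (- (1 / 2) * xcot t -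
      sum_n (fun m => zeta (2 * m) * (t / 2) ^ (2 * m)) n)). nra.
  - apply (is_lim_seq_ext (fun n => (1 / 4) ^ n)).
    + intros n. now rewrite int01_const.
    + apply is_lim_seq_geom. rewrite Rabs_pos_eq; lra.
Qed.

(** * Sine moments of powers *)

Definition sin_moment (p k : nat) : R := int01 (fun t => t ^ p * sin (freq k * t)).

(** Here [f t = t ^ (q + 1)] vanishes at [0], so that [f t / sin (PI / 2 * t)] is
    continuous, and [f t * cot (PI / 2 * t)] is [2 / PI * (t ^ q * xcot t)]. *)
Lemma xcot_moment q :
  is_series (fun k => PI * sin_moment (S q) k) (int01 (fun t => t ^ q * xcot t)).
Proof.
  pose proof PI_RGT_0 as hpi. pose proof cont01_xcot as hx.
  set (h := fun t => 2 / PI * (t ^ q * / sinc (PI / 2 * t))).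
  assert (hh : cont01 h) by (unfold h; cont; apply cont01_inv_sinc).
  assert (hd : is_series (fun k => 2 * sin_moment (S q) k)
     (int01 (fun t => h t * cos (PI / 2 * t)))).
  { apply (dirichlet_sin (fun t => t ^ S q) h); [cont | exact hh |].
    intros t ht. unfold h. pose proof (sinc_half_pos t ltac:(lra)).
    rewrite (sin_sinc (PI / 2 * t)). simpl. field. lra. }
  apply (is_series_scal_R (PI / 2)) in hd.
  replace (int01 (fun t => t ^ q * xcot t)) with
    (PI / 2 * (int01 (fun t => h t * cos (PI / 2 * t)))).
  - apply is_series_ext_R with (2 := hd). intros k.
    field.
  - rewrite <- int01_scal by cont.
    apply int01_ext. intros t ht. unfold h, xcot.
    pose proof (sinc_half_pos t ltac:(lra)). field. lra.
Qed.

(** Two integrations by parts; the only boundary term that survives is the one of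
    the cosine at [t = 1]. *)
Lemma sin_moment_SS p k :
  sin_moment (S (S p)) k
  = (-1) ^ k / freq k - INR (S (S p)) * INR (S p) / freq k ^ 2 * sin_moment p k.
Proof.
  pose proof (freq_pos k) as hw. set (w := freq k) in *.
  assert (h : int01 (fun t => t ^ S (S p) * sin (w * t)
     + INR (S (S p)) * INR (S p) / w ^ 2 * (t ^ p * sin (w * t))) = (-1) ^ k / w).
  { rewrite (int01_derive (fun t => - t ^ S (S p) * cos (w * t) / w
       + INR (S (S p)) * t ^ S p * sin (w * t) / w ^ 2)).
    - rewrite !pow1, !pow_i, !Rmult_1_r by lia. unfold w at 1 3.
      rewrite cos_freq, sin_freq, pow_add. field. lra.
    - cont.
    - intros t _. auto_derive; [auto|].
      change (match p with 0%nat => 1 | S _ => INR p + 1 end) with (INR (S p)).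
      rewrite (S_INR (S p)). simpl (Init.Nat.pred _). simpl (_ ^ S _). field. lra. }
  rewrite int01_plus, int01_scal in h by cont.
  unfold sin_moment. fold w. lra.
Qed.

Definition coef (p j : nat) : R := INR (fact p) * (-1) ^ j / INR (fact (p - 2 * j)).

Lemma coef_SS p j : coef (S (S p)) (S j) = - (INR (S (S p)) * INR (S p)) * coef p j.
Proof.
  unfold coef. replace (S (S p) - 2 * S j)%nat with (p - 2 * j)%nat by lia.
  rewrite !fact_simpl, !mult_INR. simpl ((-1) ^ S j). field. apply INR_fact_neq_0.
Qed.

Lemma coef_0 p : coef p 0 = 1.
Proof.
  unfold coef. rewrite Nat.mul_0_r, Nat.sub_0_r. simpl. field. apply INR_fact_neq_0.
Qed.

(** When [p] is even the recursion ends at the moment of [t ^ 0], whose boundary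
    term at [t = 0] does not vanish; this is the coefficient of that contribution. *)
Definition even_coef (p : nat) : R :=
  if Nat.even p then INR (fact p) * (-1) ^ (p / 2) / PI ^ p else 0.

(** Strong induction on [p] in steps of two, from [p = 0] and [p = 1]: the recursion
    multiplies the coefficients by [- (p + 2) * (p + 1)], shifts the index [j] by one
    and adds the term [j = 0]. *)
Lemma sin_moment_closed k p :
  PI * sin_moment p k =
    sum_n (fun j => coef p j / PI ^ (2 * j) * ((-1) ^ k / INR (k + 1) ^ (2 * j + 1))) (p / 2)
    + even_coef p * (1 / INR (k + 1) ^ (p + 1)).
Proof.
  pose proof (freq_pos k) as hw. pose proof (INR_add1_pos k) as hk. pose proof PI_RGT_0 as hpi.
  induction p as [p IH] using lt_wf_ind. destruct p as [|[|p]].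
  - unfold sin_moment, even_coef. simpl (0 / 2)%nat. rewrite sum_O, coef_0.
    rewrite (int01_derive (fun t => - cos (freq k * t) / freq k)).
    + rewrite Rmult_1_r, Rmult_0_r, cos_0, cos_freq, pow_add. unfold freq.
      simpl. field. lra.
    + cont.
    + intros t _. auto_derive; auto. field. lra.
  - unfold sin_moment, even_coef. simpl (1 / 2)%nat. rewrite sum_O, coef_0.
    rewrite (int01_derive (fun t => - t * cos (freq k * t) / freq k
       + sin (freq k * t) / freq k ^ 2)).
    + rewrite !Rmult_1_r, !Rmult_0_r, sin_0, cos_freq, sin_freq, pow_add. unfold freq.
      simpl. field. lra.
    + cont.
    + intros t _. auto_derive; auto. simpl. field. lra.
  - specialize (IH p ltac:(lia)). rewrite sin_moment_SS.
    replace (S (S p) / 2)%nat with (S (p / 2))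
      by (replace (S (S p)) with (p + 1 * 2)%nat by lia; rewrite Nat.div_add; lia).
    unfold sum_n. rewrite sum_Sn_m, <- sum_n_m_S by lia. fold (sum_n (fun j =>
      coef (S (S p)) (S j) / PI ^ (2 * S j) * ((-1) ^ k / INR (k + 1) ^ (2 * S j + 1))) (p / 2)).
    rewrite (sum_n_ext_R _ (fun j => mult (- (INR (S (S p)) * INR (S p)) / freq k ^ 2)
      (coef p j / PI ^ (2 * j) * ((-1) ^ k / INR (k + 1) ^ (2 * j + 1))))).
    + rewrite (sum_n_mult_l (K := R_Ring)).
      replace (even_coef (S (S p))) with
        (- (INR (S (S p)) * INR (S p)) / PI ^ 2 * even_coef p).
      * rewrite coef_0. change (plus ?a ?b) with (a + b).
        set (s := sum_n _ _) in *.
        replace (PI * _) with (PI * (-1) ^ k / freq k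
          - INR (S (S p)) * INR (S p) / freq k ^ 2 * (PI * sin_moment p k)) by (field; lra).
        rewrite IH. change (mult ?a ?b) with (a * b).
        simpl (S (S p) + 1)%nat. simpl (_ ^ S _). unfold freq.
        assert (0 < INR (k + 1) ^ (p + 1)) by now apply pow_lt.
        simpl. field. lra.
      * unfold even_coef. change (Nat.even (S (S p))) with (Nat.even p).
        destruct (Nat.even p); [|ring].
        replace (S (S p) / 2)%nat with (S (p / 2))
          by (replace (S (S p)) with (p + 1 * 2)%nat by lia; rewrite Nat.div_add; lia).
        rewrite !fact_simpl, !mult_INR, <- !tech_pow_Rmult.
        assert (0 < PI ^ p) by now apply pow_lt. field. lra.
    + intros j. rewrite coef_SS. change (mult ?a ?b) with (a * b).
      replace (2 * S j)%nat with (S (S (2 * j))) by lia.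
      change (S (S (2 * j)) + 1)%nat with (S (S (2 * j + 1))). rewrite <- !tech_pow_Rmult. unfold freq.
      assert (0 < INR (k + 1) ^ (2 * j + 1)) by now apply pow_lt.
      assert (0 < PI ^ (2 * j)) by now apply pow_lt.
      field. lra.
Qed.

(** The Dirichlet eta function; at [1] the factor [1 - 2 / 2 ^ s] vanishes at the
    pole of zeta, and the value is the limit [ln 2]. *)
Definition eta (s : nat) : R :=
  match s with 1%nat => ln 2 | _ => (1 - 2 / 2 ^ s) * zeta s end.

Lemma eta_is_series s : (1 <= s)%nat ->
  is_series (fun k => (-1) ^ k / INR (k + 1) ^ s) (eta s).
Proof.
  intros hs. destruct s as [|[|s]]; [lia | |].
  - apply is_series_ext_R with (2 := alternating_harmonic). intros k. now rewrite pow_1.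
  - apply alternating_zeta. lia.
Qed.

Lemma sin_moment_sum p : (1 <= p)%nat ->
  is_series (fun k => PI * sin_moment p k)
    (sum_n (fun j => coef p j / PI ^ (2 * j) * eta (2 * j + 1)) (p / 2)
     + even_coef p * zeta (p + 1)).
Proof.
  intros hp.
  apply is_series_ext_R with (1 := fun k => eq_sym (sin_moment_closed k p)).
  apply is_series_plus_R.
  - apply (is_series_sum_n (fun j k =>
      coef p j / PI ^ (2 * j) * ((-1) ^ k / INR (k + 1) ^ (2 * j + 1)))).
    intros j. apply is_series_scal_R, eta_is_series. lia.
  - apply is_series_scal_R, zeta_is_series. lia.
Qed.

(** * The evaluation *)

Theorem mainTheorem3 (p : nat) (hp : (1 <= p)%nat) :
  ex_series (fun n : nat => zeta (2 * n) / (INR (2 * n + p) * 4 ^ n)) /\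
  - 2 * Series (fun n : nat => zeta (2 * n) / (INR (2 * n + p) * 4 ^ n)) =
    ln 2
    + sum_n_m (fun k : nat =>
        INR (fact p) * (-1) ^ k * (4 ^ k - 1) * zeta (2 * k + 1)
        / (INR (fact (p - 2 * k)) * (2 * PI) ^ (2 * k))) 1 (p / 2)
    + (if Nat.even p
       then INR (fact p) * (-1) ^ (p / 2) * zeta (p + 1) / PI ^ p
       else 0).
Proof.
  destruct p as [|q]; [lia|].
  pose proof (zeta_series_integral q) as hs.
  split; [eexists; exact hs|].
  rewrite (is_series_unique _ _ hs).
  replace (-2 * _) with (int01 (fun t => t ^ q * xcot t)) by field.
  rewrite <- (is_series_unique _ _ (xcot_moment q)).
  rewrite (is_series_unique _ _ (sin_moment_sum (S q) hp)).
  pose proof PI_RGT_0 as hpi.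
  f_equal.
  - unfold sum_n. rewrite sum_Sn_m by lia. change (plus ?a ?b) with (a + b).
    f_equal.
    + rewrite coef_0. simpl. field.
    + apply sum_n_m_ext_loc_R. intros j hj. unfold coef.
      destruct j as [|j]; [lia|].
      replace (2 * S j + 1)%nat with (S (S (2 * j + 1))) by lia.
      unfold eta. replace (2 * S j)%nat with (S (2 * j + 1)) by lia.
      set (z := zeta _). set (d := fact (S q - S (2 * j + 1))).
      assert (h4 : 4 ^ S j = 2 ^ S (2 * j + 1)).
      { replace (S (2 * j + 1)) with (2 * S j)%nat by lia. rewrite pow_mult. f_equal. ring. }
      rewrite h4, Rpow_mult_distr. rewrite <- (tech_pow_Rmult 2 (S _)).
      pose proof (INR_fact_neq_0 (S q - S (2 * j + 1))). fold d in H.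
      assert (0 < 2 ^ S (2 * j + 1)) by (apply pow_lt; lra).
      assert (0 < PI ^ S (2 * j + 1)) by now apply pow_lt.
      field. lra.
  - unfold even_coef. destruct (Nat.even (S q)); [|ring].
    field. apply pow_nonzero. lra.
Qed.
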